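(* There exists a configuration $c\in\mathbb{F}_2[[X^{\pm1},Y^{\pm1}]]$ annihilated by $f_T=(1+X^2)(1+Y^2)\in\mathbb{F}_2[X^{\pm1},Y^{\pm1}]$ (that is, $f_Tc=0$) which is not periodic but has low complexity.
   Context: $\mathbb{F}_2[X^{\pm1},Y^{\pm1}]$ is the ring of Laurent polynomials over the two-element field, and $\mathbb{F}_2[[X^{\pm1},Y^{\pm1}]]$ is the set of formal two-sided power series $c=\sum_{(i,j)\in\mathbb{Z}^2}c_{i,j}X^iY^j$ (equivalently, configurations $c\in\mathbb{F}_2^{\mathbb{Z}^2}$), a module over the Laurent polynomial ring under the formal product. The translation by $\mathbf{t}\in\mathbb{Z}^2$ is $\tau_{\mathbf{t}}(c)_{\mathbf{n}}=c_{\mathbf{n}-\mathbf{t}}$. A configuration $c$ is periodic if $\tau_{\mathbf{t}}(c)=c$ for some non-zero $\mathbf{t}\in\mathbb{Z}^2$. For a finite $D\subset\mathbb{Z}^2$, $P(c,D)=\{\tau_{\mathbf{t}}(c)_{|D} : \mathbf{t}\in\mathbb{Z}^2\}$ is the set of $D$-patterns of $c$. The configuration $c$ has low complexity if $|P(c,D)|\le|D|$ for some finite $D\subset\mathbb{Z}^2$ (of any shape). *)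

(* Defs.v *)
From HB Require Import structures.
From mathcomp Require Import all_boot all_order all_algebra.
From mathcomp Require Import finmap.
From mathcomp Require Import boolp functions.

Set Implicit Arguments.
Unset Strict Implicit.
Unset Printing Implicit Defensive.

Import GRing.Theory.
Local Open Scope fset_scope.
Local Open Scope ring_scope.

Notation Z2 := (int * int)%type.

(* The value at (i, j) is the coefficient of X^i Y^j. *)
Definition laurent := {fsfun Z2 -> 'F_2 with 0}.
HB.instance Definition _ := Choice.on laurent.

Definition config := Z2 -> 'F_2.
HB.instance Definition _ := GRing.Zmodule.on config.

(* Formal product of a Laurent polynomial and a two-sided series. *)
Definition conv (f : laurent) (c : Z2 -> 'F_2) (n : Z2) : 'F_2 :=
  \sum_(t <- finsupp f) f t * c (n - t).

Definition lmonom (t : Z2) : laurent := [fsfun n in [fset t] => 1].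

Definition lzero : laurent := [fsfun].

Definition ladd (f g : laurent) : laurent :=
  [fsfun n in finsupp f `|` finsupp g => f n + g n].

Definition lopp (f : laurent) : laurent := [fsfun n in finsupp f => - f n].

Definition lmul (f g : laurent) : laurent :=
  [fsfun n in [fset s + t | s in finsupp f, t in finsupp g] => conv f g n].

Lemma laurentP (f g : laurent) : f =1 g -> f = g.
Proof. by move=> fg; apply/fsfunP. Qed.

Lemma lzeroE n : lzero n = 0.
Proof. by rewrite /lzero fsfunE. Qed.

Lemma lmonomE t n : lmonom t n = (n == t)%:R.
Proof. by rewrite /lmonom fsfunE !inE; case: eqP. Qed.

Lemma laddE f g n : ladd f g n = f n + g n.
Proof.
rewrite /ladd fsfunE !inE; case: (finsuppP f n) => //= _.
by case: (finsuppP g n) => //= _; rewrite addr0.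
Qed.

Lemma loppE f n : lopp f n = - f n.
Proof. by rewrite /lopp fsfunE; case: (finsuppP f n) => //= _; rewrite oppr0. Qed.

Lemma conv_incl (A : {fset Z2}) f c n : finsupp f `<=` A ->
  conv f c n = \sum_(t <- A) f t * c (n - t).
Proof.
move=> fA; apply: big_fset_incl => // t _ tNf.
by rewrite (fsfun_dflt tNf) mul0r.
Qed.

Lemma lmulE f g n : lmul f g n = conv f g n.
Proof.
rewrite /lmul fsfunE; case: ifPn => // nNfg; symmetry.
rewrite /conv big_seq big1 // => t tf.
rewrite [g _]fsfun_dflt ?mulr0 //; apply: contra nNfg => ntg.
by apply/imfset2P; exists t => //; exists (n - t) => //; rewrite addrC subrK.
Qed.

Lemma eq_conv f c d : c =1 d -> conv f c =1 conv f d.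
Proof. by move=> cd n; apply: eq_bigr => t _; rewrite cd. Qed.

Lemma conv_addl f g c n : conv (ladd f g) c n = conv f c n + conv g c n.
Proof.
have fA : finsupp f `<=` finsupp f `|` finsupp g by rewrite fsubsetUl.
have gA : finsupp g `<=` finsupp f `|` finsupp g by rewrite fsubsetUr.
rewrite (conv_incl _ _ fA) (conv_incl _ _ gA) -big_split /=.
rewrite (@conv_incl (finsupp f `|` finsupp g)).
  by apply: eq_bigr => t _; rewrite laddE mulrDl.
by apply/fsubsetP => t; rewrite mem_finsupp fsfunE; case: ifP; rewrite ?eqxx.
Qed.

Lemma conv_monom t c n : conv (lmonom t) c n = c (n - t).
Proof.
rewrite (@conv_incl [fset t]).
  by rewrite big_seq_fset1 lmonomE eqxx mul1r.
by apply/fsubsetP => s; rewrite mem_finsupp lmonomE !inE; case: (s == t); rewrite ?eqxx.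
Qed.

Lemma conv_reindex (f g : laurent) (c : Z2 -> 'F_2) s n (A : {fset Z2}) :
    s \in finsupp f -> A = [fset s + t | s in finsupp f, t in finsupp g] ->
  \sum_(u <- A) g (u - s) * c (n - u) = conv g c (n - s).
Proof.
move=> sf ->.
have injs : {in finsupp g &, injective (+%R s)} by move=> ? ? _ _ /addrI.
transitivity (\sum_(u <- [fset s + t | t in finsupp g]) g (u - s) * c (n - u)).
  symmetry; apply: big_fset_incl.
    apply/fsubsetP => u /imfsetP[t tg ->].
    by apply/imfset2P; exists s => //; exists t.
  move=> u _ uN; rewrite [g _]fsfun_dflt ?mul0r //; apply: contra uN => us.
  by apply/imfsetP; exists (u - s) => //; rewrite addrC subrK.
rewrite big_imfset //=; apply: eq_bigr => t _.
by rewrite [s + t]addrC addrK opprD [- t - s]addrC addrA.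
Qed.

Lemma conv_mul f g c n : conv (lmul f g) c n = conv f (conv g c) n.
Proof.
pose A := [fset s + t | s in finsupp f, t in finsupp g].
rewrite (@conv_incl A); last first.
  by apply/fsubsetP => u; rewrite mem_finsupp fsfunE; case: ifP; rewrite ?eqxx.
under eq_bigr do rewrite lmulE mulr_suml.
rewrite exchange_big /= /conv big_seq [RHS]big_seq; apply: eq_bigr => s sf.
under eq_bigr do rewrite -mulrA.
by rewrite -mulr_sumr (@conv_reindex f g c s n A).
Qed.

Fact laddA : associative ladd.
Proof. by move=> f g h; apply: laurentP => n; rewrite !laddE addrA. Qed.
Fact laddC : commutative ladd.
Proof. by move=> f g; apply: laurentP => n; rewrite !laddE addrC. Qed.
Fact ladd0 : left_id lzero ladd.
Proof. by move=> f; apply: laurentP => n; rewrite laddE lzeroE add0r. Qed.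
Fact laddN : left_inverse lzero lopp ladd.
Proof. by move=> f; apply: laurentP => n; rewrite laddE loppE lzeroE addNr. Qed.

HB.instance Definition _ :=
  GRing.isZmodule.Build laurent laddA laddC ladd0 laddN.

Fact lmulA : associative lmul.
Proof.
move=> f g h; apply: laurentP => n; rewrite !lmulE conv_mul.
by apply: eq_conv => m; rewrite lmulE.
Qed.

Fact lmulC : commutative lmul.
Proof.
move=> f g; apply: laurentP => n; rewrite !lmulE.
pose A := [fset n - t | t in finsupp f] `|` finsupp g.
rewrite (@conv_incl A g) ?fsubsetUr //.
transitivity (\sum_(t <- [fset n - t | t in finsupp f]) g t * f (n - t)).
  rewrite big_imfset /=; last by move=> ? ? _ _ /addrI/oppr_inj.
  by apply: eq_bigr => t _; rewrite opprB [n + (t - n)]addrC subrK mulrC.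
apply: big_fset_incl; first exact: fsubsetUl.
move=> t _ tN; rewrite [f _]fsfun_dflt ?mulr0 //; apply: contra tN => nt.
by apply/imfsetP; exists (n - t) => //; rewrite opprB addrC subrK.
Qed.

Fact lmul1 : left_id (lmonom 0) lmul.
Proof. by move=> f; apply: laurentP => n; rewrite lmulE conv_monom subr0. Qed.

Fact lmulDl : left_distributive lmul ladd.
Proof.
by move=> f g h; apply: laurentP => n; rewrite laddE !lmulE conv_addl.
Qed.

Fact lone_neq0 : lmonom 0 != lzero.
Proof.
by apply/eqP => /(congr1 (fun f : laurent => f 0)); rewrite lmonomE lzeroE.
Qed.

HB.instance Definition _ := GRing.Zmodule_isComNzRing.Build laurent
  lmulA lmulC lmul1 lmulDl lone_neq0.

Definition lscale (f : laurent) (c : config) : config := conv f c.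

Fact lscaleA f g c : lscale f (lscale g c) = lscale (f * g) c.
Proof. by apply/funext => n; rewrite /lscale conv_mul. Qed.
Fact lscale1 : left_id 1 lscale.
Proof. by move=> c; apply/funext => n; rewrite /lscale conv_monom subr0. Qed.
Fact lscaleDr : right_distributive lscale +%R.
Proof.
move=> f c d; apply/funext => n; transitivity (conv f c n + conv f d n) => //.
rewrite -big_split /=.
by apply: eq_bigr => t _; rewrite -mulrDr.
Qed.
Fact lscaleDl c : {morph lscale^~ c : f g / f + g}.
Proof. by move=> f g; apply/funext => n; rewrite /lscale conv_addl. Qed.

HB.instance Definition _ := GRing.Zmodule_isLmodule.Build laurent config
  lscaleA lscale1 lscaleDr lscaleDl.

Definition lX : laurent := lmonom (1, 0).
Definition lY : laurent := lmonom (0, 1).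

Definition f_T : laurent := (1 + lX ^+ 2) * (1 + lY ^+ 2).

Definition translate (t : Z2) (c : config) : config := fun n => c (n - t).

Definition periodic (c : config) : Prop :=
  exists t : Z2, t <> 0 /\ translate t c = c.

Definition restrict (D : {fset Z2}) (c : config) : {ffun D -> 'F_2} :=
  [ffun n : D => c (val n)].

Definition patterns (c : config) (D : {fset Z2}) : {set {ffun D -> 'F_2}} :=
  [set p | `[< exists t : Z2, p = restrict D (translate t c) >]].

Definition low_complexity (c : config) : Prop :=
  exists D : {fset Z2}, (#|patterns c D| <= #|` D|)%N.

(* Main.v *)
Require Import Defs.
From mathcomp Require Import all_boot all_order all_algebra.
From mathcomp Require Import finmap boolp functions.
From mathcomp Require Import zify.
Import GRing.Theory.
Local Open Scope ring_scope.

(** Place a horizontal line of ones on the even points of the row y = 0, and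
    a vertical line on the even points of the column x = 1.  The first line is
    fixed by X^2 and the second by Y^2, so f_T kills both, and the two
    directions together exclude any period.  A shape contained in (2Z)^2 only
    ever sees one coset of (2Z)^2, hence at most one of the two lines: the
    doubled n x n square has at most 2n + 1 patterns, and 2n + 1 <= n^2 for
    n = 3. *)

Definition evenz (i : int) : bool := ~~ odd `|i|%N.

Definition in_cross (n : Z2) : bool :=
  (n.2 == 0) && evenz n.1 || (n.1 == 1) && evenz n.2.

Definition cross : config := fun n => (in_cross n)%:R.

Lemma f_T_scaleE (c : config) (x y : int) :
  (f_T *: c) (x, y) = c (x, y) + c (x, y - 2) + (c (x - 2, y) + c (x - 2, y - 2)).
Proof.
have X2E (d : config) n : (lX ^+ 2 *: d) n = d (n - (1, 0) - (1, 0)).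
  by rewrite expr2 -scalerA; do 2 rewrite [LHS]conv_monom.
have Y2E (d : config) n : (lY ^+ 2 *: d) n = d (n - (0, 1) - (0, 1)).
  by rewrite expr2 -scalerA; do 2 rewrite [LHS]conv_monom.
have shiftE (d : config) (x1 y1 x2 y2 : int) :
  x1 = x2 -> y1 = y2 -> d (x1, y1) = d (x2, y2) by move=> -> ->.
rewrite /f_T -scalerA !scalerDl !scale1r scalerDr.
(* Addition of configurations is pointwise, so evaluation at [(x, y)] distributes over the sum by
   conversion. *)
rewrite [LHS]/(c (x, y) + (lY ^+ 2 *: c) (x, y) +
  ((lX ^+ 2 *: c) (x, y) + (lX ^+ 2 *: (lY ^+ 2 *: c)) (x, y))).
rewrite !X2E !Y2E.
by congr (_ + _ + (_ + _)); apply: shiftE => /=; lia.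
Qed.

Lemma f_T_cross : f_T *: cross = 0.
Proof.
apply/funext => -[x y]; rewrite f_T_scaleE [RHS]/(0 : 'F_2) /cross /in_cross /=.
have evenB2 (i : int) : evenz (i - 2) = evenz i by rewrite /evenz; lia.
(* For even [x] only the row contributes, and the terms at [x] and [x - 2] cancel in characteristic
   2; for odd [x] only the column does, and [y] cancels against [y - 2]. *)
rewrite !evenB2; have [ex|ox] := boolP (evenz x).
  have -> : (x == 1) = false by move: ex; rewrite /evenz; lia.
  have -> : (x - 2 == 1) = false by move: ex; rewrite /evenz; lia.
  by rewrite !orbF; case: (y == 0); case: (y - 2 == 0); apply/eqP.
by rewrite !andbF /=; case: (evenz y); case: (x == 1); case: (x - 2 == 1);
  apply/eqP.
Qed.

Lemma cross_aperiodic : ~ periodic cross.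
Proof.
move=> [[a b] [nz_t per_t]].
have per n : in_cross (n - (a, b)) = in_cross n.
  have /(congr1 (fun d : config => d n)) := per_t.
  by rewrite /translate /cross; do 2 case: in_cross.
(* The column meets any row at most once, so the shifted points of the row can only lie on the row
   itself, whence [b = 0]; symmetrically [a = 0]. *)
apply: nz_t; move: (per (0, 0)) (per (2, 0)) (per (4, 0)) (per (1, 0))
  (per (1, 2)) (per (1, 4)) => /=.
rewrite /in_cross /evenz /= => h1 h2 h3 h4 h5 h6.
by congr pair; lia.
Qed.

Definition double_pt (p : 'I_3 * 'I_3) : Z2 := ((2 * p.1)%N%:Z, (2 * p.2)%N%:Z).

Definition double_square : {fset Z2} :=
  [fset double_pt p | p in {: 'I_3 * 'I_3}]%fset.

Lemma card_double_square : #|` double_square| = 9.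
Proof.
rewrite card_imfset /=; last first.
  by move=> [i j] [k l] [ik jl]; congr pair; apply: val_inj => /=; lia.
by rewrite -cardE card_prod card_ord.
Qed.

(** Codes for the patterns seen in the doubled square: [None] is the blank one, and the boolean is
    true for a vertical line. *)
Definition line (o : option (bool * 'I_3)) (n : Z2) : bool :=
  if o is Some (v, k) then (if v then n.1 else n.2) == (2 * k)%N%:Z else false.

Lemma in_cross_line (t : Z2) :
  exists o, forall p, in_cross (double_pt p - t) = line o (double_pt p).
Proof.
case: t => a b.
(* For odd [a] a doubled point can only hit the column, when [2i = a + 1] and [b] is even; for even
   [a], only the row, when [2j = b]. *)
pose v := ~~ evenz a; pose r := if v then a + 1 else b.
have [/andP[vb /existsP[k /eqP rk]]|off] :=
  boolP ((v ==> evenz b) && [exists k : 'I_3, r == (2 * k)%N%:Z]).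
  exists (Some (v, k)) => -[i j]; move: vb rk.
  by rewrite /in_cross /line /r /v /evenz /=; case: ifP; lia.
(* A one seen at [(2i, 2j)] would supply the missing [k], namely [i] or [j]. *)
exists None => -[i j] /=; apply: contraNF off.
rewrite /in_cross /r /v /evenz /= => h.
apply/andP; split; first lia.
by apply/existsP; exists (if ~~ evenz a then i else j);
  move: h; rewrite /evenz; case: ifP; lia.
Qed.

Lemma cross_low_complexity : low_complexity cross.
Proof.
exists double_square; rewrite card_double_square.
pose g o : {ffun double_square -> 'F_2} := [ffun n => (line o (val n))%:R].
have sub : patterns cross double_square \subset [set g o | o in predT].
  apply/subsetP => p; rewrite inE => /asboolP[t ->].
  have [o oE] := in_cross_line t; apply/imsetP; exists o => //.
  apply/ffunP => n; rewrite !ffunE /translate /cross.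
  by have /imfsetP[q _ ->] := valP n; rewrite oE.
apply: leq_trans (subset_leq_card sub) _.
apply: leq_trans (leq_imset_card _ _) _.
(* One blank code and two directions with three positions each: 7 is at most 9. *)
by rewrite card_option card_prod card_bool card_ord.
Qed.

Theorem theorem11 :
  exists c : config, f_T *: c = 0 /\ ~ periodic c /\ low_complexity c.
Proof.
exists cross; split; first exact: f_T_cross.
by split; [exact: cross_aperiodic | exact: cross_low_complexity].
Qed.
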